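(* Let $\alpha$ be a divisible irrational number, with chosen subsequence $(q_n)_{n\ge1}$ of continuants and convergents $\alpha_n=p_n/q_n$, and let $\tilde F_n$ be the rational truncated skew products, as specified in the context. For $n\ge1$ and $x\in\mathbb{T}$ let $$S^{\tilde F_n}_{q_{n+1}}(x)=\#\left\{1\le k\le q_{n+1}\,:\,\tilde F_n^{\,k}(x,0)\in\mathbb{T}\times\{0\}\right\}.$$ Then for every $m\in\{-n,\ldots,n\}$ with the same parity as $n$, the equality $$S^{\tilde F_n}_{q_{n+1}}(x)=\frac{q_{n+1}}{2^n}\binom{n}{\frac{n+m}{2}}$$ holds for all $x$ in some measurable subset of $\mathbb{T}$ of Lebesgue measure $\frac{1}{2^n}\binom{n}{\frac{n+m}{2}}$.
   Context: $\mathbb{T}=\mathbb{R}/\mathbb{Z}$, parameterized by $[0,1)$, and $\|x\|$ is the distance from $x\in\mathbb{R}$ to the closest integer. The continuants of an irrational $\alpha=[a_0;a_1,a_2,\ldots]$ are the denominators of its convergents $[a_0;a_1,\ldots,a_k]$ in lowest terms. An irrational $\alpha$ is divisible if it has a subsequence of continuants along which each term, doubled, divides the next term and along which (continuant $q$) the quantity $q\|q\alpha\|$ tends to $0$. Throughout, $\alpha$ is divisible and $(q_n)_{n\ge1}$ denotes a strictly increasing subsequence of (not all) its continuants, re-indexed, such that $2q_n$ divides $q_{n+1}$ for all $n$ and $\lim_{n}q_n\|q_n\alpha\|=0$; $\alpha_n=p_n/q_n$ is the convergent of $\alpha$ (in lowest terms) with denominator $q_n$. After passing to a subsequence it is also assumed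 that: $2\sum_{j>n}\|q_j\alpha\|<\|q_n\alpha\|$ for all $n\ge1$; $\sum_{j\ge1}j^{p+1}\|q_j\alpha\|<\infty$ for all $p\ge1$; for each $p\ge1$, $\sum_{j=1}^n j^{p+1}q_j<q_{n+1}$ for all sufficiently large $n$ (depending on $p$); $\left(2^n\sum_{j=1}^{n-1}q_j\right)q_n\|q_n\alpha\|<1$ for all $n\ge1$; and $\{\alpha,2\alpha,\ldots,q_{n+1}\alpha\}$ is $\left(\frac{1}{2q_n}\right)^2$-dense in $\mathbb{T}$ for all $n\ge1$. Let $T:\mathbb{T}\to\mathbb{Z}$ be the Haar function, $T(x)=1$ for $x\in[0,\frac12)$ and $T(x)=-1$ for $x\in[\frac12,1)$, and $T_j(x)=T(q_jx)$ (arguments taken modulo $1$). Define $$\tilde\phi_n(x)=\frac12\sum_{j=1}^n\left[T_j(x+\alpha_{n+1})-T_j(x)\right],\qquad \tilde F_n:\mathbb{T}\times\mathbb{Z}\to\mathbb{T}\times\mathbb{Z},\quad \tilde F_n(x,y)=(x+\alpha_{n+1},\,y+\tilde\phi_n(x)).$$ *)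

(* Defs.v *)
From HB Require Import structures.
From mathcomp Require Import all_boot all_order all_algebra.
From mathcomp Require Import all_classical all_reals all_analysis.

Set Implicit Arguments.
Unset Strict Implicit.
Unset Printing Implicit Defensive.

Import Order.TTheory GRing.Theory Num.Theory.
Import numFieldNormedType.Exports.

Local Open Scope classical_set_scope.
Local Open Scope ring_scope.

(* The circle R/Z is represented by the interval [0, 1[, with translations    *)
(* taken modulo 1 through frac.                                               *)
Definition circle (R : realType) : set R := [set` `[0%R, 1%R[].
Arguments circle : clear implicits.

Definition frac (R : realType) (x : R) : R := x - (Num.floor x)%:~R.

Definition dist_int (R : realType) (x : R) : R :=
  inf (range (fun z : int => `|x - z%:~R|)).

(* The quantifier over all real x, with dist_int (x - s) as the distance on   *)
(* R/Z, makes this density in the circle.                                     *)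
Definition circle_dense (R : realType) (eps : R) (S : set R) : Prop :=
  forall x : R, exists2 s, S s & dist_int (x - s) <= eps.

Section ContinuedFractions.
Variables (R : realType) (alpha : R).

Fixpoint complete_quotient (k : nat) : R :=
  if k is k'.+1 then (frac (complete_quotient k'))^-1 else alpha.

Definition partial_quotient (k : nat) : int := Num.floor (complete_quotient k).

(* [a; b, ...] = a + 1 / [b; ...] *)
Fixpoint cf_value (a : int) (s : seq int) : rat :=
  if s is b :: s' then a%:Q + (cf_value b s')^-1 else a%:Q.

Definition convergent (k : nat) : rat :=
  cf_value (partial_quotient 0) [seq partial_quotient i | i <- iota 1 k].

Definition continuant (k : nat) : nat := `|denq (convergent k)|%N.

End ContinuedFractions.

(* A subsequence of continuants is given by its indices k n, so that the      *)
(* convergent attached to each of its terms is determined. Sequences are      *)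
(* indexed by n >= 1; the values at 0 are irrelevant.                         *)
Definition q (R : realType) (alpha : R) (k : nat -> nat) (n : nat) : nat :=
  continuant alpha (k n).

Definition alpha_ (R : realType) (alpha : R) (k : nat -> nat) (n : nat) : R :=
  ratr (convergent alpha (k n)).

Record divisible_subsequence (R : realType) (alpha : R) (k : nat -> nat) :
    Prop := {
  ds_index : forall n, (0 < n)%N -> (k n < k n.+1)%N;
  ds_dvd : forall n, (0 < n)%N ->
    (2 * q alpha k n %| q alpha k n.+1)%N;
  ds_lim : (fun n => (q alpha k n)%:R *
      dist_int ((q alpha k n)%:R * alpha)) @ \oo --> (0 : R)
}.

Definition divisible (R : realType) (alpha : R) : Prop :=
  irrational alpha /\ exists k, divisible_subsequence alpha k.

Record chosen_subsequence (R : realType) (alpha : R) (k : nat -> nat) :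
    Prop := {
  cs_divisible : divisible_subsequence alpha k;
  cs_increasing : forall n, (0 < n)%N ->
    (q alpha k n < q alpha k n.+1)%N;
  (* This follows from ds_dvd, as consecutive continuants are coprime. *)
  cs_not_all : exists i, forall n, (0 < n)%N ->
    q alpha k n <> continuant alpha i;
  cs_tail : forall n, (0 < n)%N ->
    (2%:E * (\sum_(n.+1 <= j <oo)
        (dist_int ((q alpha k j)%:R * alpha))%:E)
     < (dist_int ((q alpha k n)%:R * alpha))%:E)%E;
  cs_summable : forall p, (0 < p)%N ->
    (\sum_(1 <= j <oo)
        (j%:R ^+ p.+1 * dist_int ((q alpha k j)%:R * alpha))%:E
     < +oo)%E;
  cs_growth : forall p, (0 < p)%N -> \forall n \near \oo,
    (\sum_(1 <= j < n.+1) j ^ p.+1 * q alpha k j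
     < q alpha k n.+1)%N;
  cs_small : forall n, (0 < n)%N ->
    (2 ^ n * \sum_(1 <= j < n) q alpha k j)%N%:R
      * (q alpha k n)%:R
      * dist_int ((q alpha k n)%:R * alpha) < 1;
  cs_dense : forall n, (0 < n)%N ->
    circle_dense ((2 * (q alpha k n)%:R)^-1 ^+ 2)
      [set i%:R * alpha | i in
        [set i : nat | (1 <= i <= q alpha k n.+1)%N]]
}.

Definition haar (R : realType) (x : R) : int :=
  if frac x < 2^-1 then 1 else -1.

Section SkewProduct.
Variables (R : realType) (alpha : R) (k : nat -> nat).

Definition haar_ (j : nat) (x : R) : int := haar ((q alpha k j)%:R * x).

Definition phi_sum (n : nat) (x : R) : int :=
  \sum_(1 <= j < n.+1) (haar_ j (x + alpha_ alpha k n.+1) - haar_ j x).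

(* The integer division is exact: see phi_exact. *)
Definition phi (n : nat) (x : R) : int := (phi_sum n x %/ 2)%Z.

Lemma phi_exact (n : nat) (x : R) : phi n x * 2 = phi_sum n x.
Proof.
apply/divzK; rewrite /phi_sum; apply: rpred_sum => j _.
by rewrite /haar_ /haar; do 2 case: ifP.
Qed.

Definition skew (n : nat) (z : R * int) : R * int :=
  (frac (z.1 + alpha_ alpha k n.+1), z.2 + phi n z.1).

Definition returns (n : nat) (x : R) : nat :=
  count (fun i => (iter i (skew n) (x, 0)).2 == 0) (iota 1 (q alpha k n.+1)).

End SkewProduct.

(* Main.v *)
Require Import Defs.
From mathcomp Require Import all_boot all_order all_algebra.
From mathcomp Require Import all_classical all_reals all_analysis.
From mathcomp Require Import zify ring lra.

(** Write Q for the continuant of index n + 1 and S for the sum of the first n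
    functions T_j. The fibre coordinate of the i-th iterate of (x, 0) is half
    of S (x + i p / Q) - S x, where p / Q in lowest terms is the angle of the
    rotation. A return to height 0 is thus a visit of the rotation orbit to the
    level set of S through x, and since p is coprime to Q, the first Q orbit
    points are exactly the translates of x by all multiples of 1 / Q
    ([rotation_perm], [returnsE]).

    Everything then takes place in a finite set. The divisibility relations make
    the discontinuities of every T_j multiples of 1 / Q, so T_j x depends only
    on the index l of the cell [l / Q, (l + 1) / Q) containing x: its sign is
    the parity of l %/ d_j, where d_j / Q is the half period of T_j
    ([haar_cell]). Translation by p / Q permutes the cells cyclically
    ([cell_rotate]). Hence both the number of returns and, up to the factor
    1 / Q, the measure of a level set of S ([cells_measure]) count the
    same thing: the cells l < Q for which exactly a given number of the
    quotients l %/ d_j is even.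

    This count is binomial ([count_evens]): each d_j is an even multiple of the
    next one, so the finer signs run through full periods on every half period
    of the coarser ones, which is the independence of the T_j in finite
    form. *)

Set Implicit Arguments.
Unset Strict Implicit.
Unset Printing Implicit Defensive.

Import Order.TTheory GRing.Theory Num.Theory.

Local Open Scope classical_set_scope.
Local Open Scope ring_scope.

(** * Counting parities of quotients *)

Definition evens (ds : seq nat) (l : nat) : nat :=
  count (fun d => ~~ odd (l %/ d)) ds.

Lemma odd_divn_periodic (e d a r : nat) : (2 * e %| d)%N ->
  odd ((a * d + r) %/ e) = odd (r %/ e).
Proof.
case: (posnP e) => [-> |e0]; first by rewrite !divn0.
case/dvdnP=> b ->.
have -> : (a * (b * (2 * e)) + r = (a * b * 2) * e + r)%N by lia.
by rewrite divnMDl // oddD oddM andbF.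
Qed.

(** Every period 2 d, for d in ds, divides L: the divisibility passes along the
    chain. *)
Lemma evens_periodic (L : nat) (ds : seq nat) (a r : nat) :
  path (fun b c => 2 * c %| b)%N L ds -> evens ds (a * L + r) = evens ds r.
Proof.
elim: ds L a => [//|d ds IH] L a /= /andP[dL pds].
rewrite /evens /= odd_divn_periodic // -/(evens _ _) -/(evens _ _); congr addn.
have /dvdnP[b ->] := dvdn_trans (dvdn_mull 2 (dvdnn d)) dL.
by rewrite mulnA IH.
Qed.

Lemma count_iotaM (P : pred nat) (t d : nat) :
  count P (iota 0 (t * d)) =
  (\sum_(s < t) count (fun r => P (s * d + r)) (iota 0 d))%N.
Proof.
elim: t => [|t IH]; first by rewrite mul0n big_ord0.
rewrite mulSnr iotaD count_cat IH big_ord_recr /= add0n.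
congr addn; rewrite -[X in iota X](addn0 (t * d)%N) iotaDl count_map.
by apply: eq_count => r /=.
Qed.

(** Finite independence, by induction on the chain: cut [0, L) into an
    even number of blocks whose length d is the coarsest half period. The parity
    of l %/ d alternates from block to block while the remaining entries of the
    chain see the same pattern in every block, so Pascal's rule gives the
    coefficient. *)
Lemma count_evens (L : nat) (ds : seq nat) (a : nat) :
  path (fun b c => 2 * c %| b)%N L ds ->
  (2 ^ size ds * count (fun l => evens ds l == a) (iota 0 L)
   = L * 'C(size ds, a))%N.
Proof.
elim: ds L a => [|d ds IH] L a /=.
  rewrite mul1n; case: a => [|a] _; rewrite /evens /=.
    by rewrite (eq_count (a2 := predT)) // count_predT size_iota bin0 muln1.
  by rewrite (eq_count (a2 := pred0)) // count_pred0 bin0n muln0.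
case/andP=> /dvdnP[t ->] pds.
have [->|d0] := posnP d; first by rewrite !muln0 mul0n.
rewrite [(t * _)%N]mulnA count_iotaM.
have blk (s : nat) :
    count (fun r => evens (d :: ds) (s * d + r) == a) (iota 0 d)
    = count (fun r => (~~ odd s + evens ds r)%N == a) (iota 0 d).
  apply: eq_in_count => r; rewrite mem_iota add0n /= => rd.
  rewrite {1}/evens /= -/(evens _ _) (evens_periodic _ _ pds).
  by rewrite divnMDl // divn_small // addn0.
under eq_bigr do rewrite blk.
have -> : (\sum_(s < t * 2)
     count (fun r => (~~ odd s + evens ds r)%N == a) (iota 0 d)
   = t * (count (fun r => (1 + evens ds r)%N == a) (iota 0 d)
        + count (fun r => evens ds r == a) (iota 0 d)))%N.
  elim: t {pds} => [|t IHt]; first by rewrite big_ord0.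
  rewrite mulSnr !addnS addn0 !big_ord_recr /= IHt mulSnr oddM andbF /=.
  by rewrite -addnA.
rewrite expnS {blk}.
have := IH d a pds; set c0 := count (fun r => evens ds r == a) _.
case: a @c0 => [|a] c0 c0E.
  have -> : count (fun r => (1 + evens ds r)%N == 0%N) (iota 0 d) = 0%N.
    by rewrite (eq_count (a2 := pred0)) // count_pred0.
  rewrite !bin0 in c0E *.
  by rewrite add0n mulnACA c0E; lia.
have := IH d a pds.
have -> : count (fun r => (1 + evens ds r)%N == a.+1) (iota 0 d)
   = count (fun r => evens ds r == a) (iota 0 d) by apply: eq_count.
set c1 := count _ _ => c1E.
by rewrite binS mulnACA mulnDr c0E c1E; lia.
Qed.

(** * Haar functions on the cells of the circle *)

Section Circle.
Variable R : realType.
Implicit Types x : R.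
Local Notation frac := Defs.frac.

Lemma frac_itv x : 0 <= frac x < 1.
Proof. by have := floor_itv x; rewrite /Defs.frac intrD; lra. Qed.

Lemma frac_eq x (z : int) : 0 <= x - z%:~R < 1 -> frac x = x - z%:~R.
Proof. by move=> h; rewrite /Defs.frac (@floor_def _ x z) // intrD; lra. Qed.

Lemma fracDz x (z : int) : frac (x + z%:~R) = frac x.
Proof.
rewrite (@frac_eq _ (Num.floor x + z)); first by rewrite /Defs.frac intrD; ring.
by have := frac_itv x; rewrite /Defs.frac intrD; lra.
Qed.

Lemma haar_frac (j : nat) x : haar (j%:R * frac x) = haar (j%:R * x).
Proof.
rewrite /haar -(fracDz (j%:R * frac x) (j%:Z * Num.floor x)).
by congr (if frac _ < _ then _ else _); rewrite intrM /Defs.frac; ring.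
Qed.

Lemma haar_half x (t : nat) : t%:R <= 2 * x < t.+1%:R ->
  haar x = if odd t then -1 else 1.
Proof.
have h : t%:R = (odd t)%:R + 2 * (t./2)%:R :> R.
  by rewrite -natrM -natrD mul2n odd_double_half.
rewrite -[t.+1%:R]natr1 h => /andP[h1 h2].
have fE : frac x = x - (t./2)%:R.
  apply: (@frac_eq x (t./2)).
  by rewrite -pmulrn; move: h1 h2; case: (odd t) => /=; lra.
have -> : haar x = if odd t == false then 1 else -1; last by case: (odd t).
rewrite /haar fE; congr (if _ then _ else _); move: h1 h2.
case: (odd t) => /= h1 h2; last by rewrite eqxx; apply/idP; lra.
by apply/negbTE; rewrite -leNgt; lra.
Qed.

Definition cell (Q : nat) x : nat := Num.truncn (Q%:R * frac x).

Lemma cell_bounds Q x : (cell Q x)%:R <= Q%:R * frac x < (cell Q x).+1%:R.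
Proof. by apply: truncn_itv; rewrite mulr_ge0 //; case/andP: (frac_itv x). Qed.

(** The discontinuities of the function on the left are the multiples of
    d / (2 j d), hence end points of cells. *)
Lemma haar_cell (j d : nat) x : (0 < d)%N ->
  haar (j%:R * x) = if odd (cell (2 * j * d) x %/ d) then -1 else 1.
Proof.
move=> d0; rewrite -haar_frac; apply: haar_half.
have := cell_bounds (2 * j * d) x; set l := cell _ _ => /andP[h1 h2].
have dR : 0 < d%:R :> R by rewrite ltr0n.
have a1 : (l %/ d * d)%:R <= l%:R :> R by rewrite ler_nat leq_trunc_div.
have a2 : l.+1%:R <= ((l %/ d).+1 * d)%:R :> R by rewrite ler_nat ltn_ceil.
rewrite !natrM in h1 h2 a1 a2.
have e : 2 * j%:R * d%:R * frac x = (2 * (j%:R * frac x)) * d%:R by ring.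
rewrite e in h1 h2.
rewrite -(ler_pM2r dR) -[X in _ && X](ltr_pM2r dR).
by rewrite (le_trans a1 h1) (lt_le_trans h2 a2).
Qed.

Lemma cell_rotate (Q : nat) x (p : int) : (0 < Q)%N ->
  cell Q (x + p%:~R / Q%:R) = `|((cell Q x)%:Z + p) %% Q%:Z|%Z%N.
Proof.
move=> Q0; have QR : 0 < Q%:R :> R by rewrite ltr0n.
have Qz : Q%:Z != 0 by lia.
set N := (cell Q x)%:Z + p; set l := `|_|%N.
pose w := (N %/ Q%:Z)%Z.
have lE : l%:Z = N - w * Q%:Z.
  by rewrite /l gez0_abs ?modz_ge0 //.
have lQ : (l < Q)%N.
  by rewrite -ltz_nat /l gez0_abs ?modz_ge0 ?ltz_pmod.
have lR : l%:R = (cell Q x)%:R + p%:~R - w%:~R * Q%:R :> R.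
  by rewrite -[l%:R]/(l%:Z%:~R) lE /N !(intrD, intrM, mulrNz).
have /andP[c1 c2] := cell_bounds Q x; rewrite -[_.+1%:R]natr1 in c2.
pose y := frac x + p%:~R / Q%:R - w%:~R.
have Qy : Q%:R * y = Q%:R * frac x + p%:~R - w%:~R * Q%:R.
  by rewrite /y; field; rewrite gt_eqF.
have y1 : l%:R <= Q%:R * y < l.+1%:R.
  by rewrite Qy lR -natr1 lR; apply/andP; split; lra.
have lQ' : l.+1%:R <= Q%:R :> R by rewrite ler_nat.
have l0 : 0 <= l%:R :> R by [].
have y2 : 0 <= y < 1.
  by rewrite -(pmulr_rge0 _ QR) -(ltr_pM2l QR) mulr1; case/andP: y1 => ? ?; lra.
have -> : cell Q (x + p%:~R / Q%:R) = Num.truncn (Q%:R * y).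
  rewrite /cell (@frac_eq _ (Num.floor x + w)).
    by rewrite /y /Defs.frac intrD; f_equal; congr (_ * _); ring.
  by move: y2; rewrite /y /Defs.frac intrD; lra.
exact: truncn_def.
Qed.

Lemma cells_measure (Q : nat) (P : pred nat) : (0 < Q)%N ->
  let A := [set x | circle R x /\ P (cell Q x)] in
  measurable A /\
  lebesgue_measure A = ((count P (iota 0 Q))%:R / Q%:R)%:E.
Proof.
move=> Q0 A; have QR : 0 < Q%:R :> R by rewrite ltr0n.
pose F (l : nat) : set R :=
  if P l then `[l%:R / Q%:R, l.+1%:R / Q%:R[%classic else set0.
have FP l x : F l x <-> P l /\ l%:R <= Q%:R * x < l.+1%:R.
  rewrite /F; case: (P l); last by split=> [|[]].
  by rewrite /= in_itv /= ler_pdivrMr // ltr_pdivlMr // mulrC; split=> [|[]].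
have mF l : measurable (F l) by rewrite /F; case: (P l).
have tF : trivIset setT F.
  move=> i j _ _ [x [/FP[_ hi] /FP[_ hj]]].
  by rewrite -(truncn_def hi) (truncn_def hj).
have AE : A = \big[setU/set0]_(l < Q) F l.
  rewrite -bigcup_mkord; apply/seteqP; split=> x.
    move=> []; rewrite /circle /= in_itv /= => /andP[x0 x1] Px.
    have xE : frac x = x by rewrite (@frac_eq x 0) ?subr0 // x0 x1.
    have /andP[h1 h2] := cell_bounds Q x; rewrite xE in h1 h2.
    exists (cell Q x) => /=; last by apply/FP; rewrite h1 h2.
    rewrite -(ltr_nat R); apply: le_lt_trans h1 _.
    by rewrite -{2}[Q%:R]mulr1 ltr_pM2l.
  move=> [l /= lQ /FP[Pl hl]]; case/andP: (hl) => h1 h2.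
  have x0 : 0 <= x by rewrite -(pmulr_rge0 _ QR) (le_trans _ h1).
  have x1 : x < 1.
    by rewrite -(ltr_pM2l QR) mulr1 (lt_le_trans h2) // ler_nat.
  split; first by rewrite /circle /= in_itv /= x0 x1.
  by rewrite /cell (@frac_eq x 0) ?subr0 ?x0 ?x1 // (truncn_def hl).
rewrite AE; split; first exact: bigsetU_measurable.
rewrite measure_bigsetU //.
have FE l : lebesgue_measure (F l) = ((P l)%:R / Q%:R)%:E.
  rewrite /F; case: (P l); last by rewrite measure0 mul0r.
  rewrite lebesgue_measure_itv /= lte_fin ltr_pM2r ?invr_gt0 // ltr_nat ltnSn.
  by rewrite -EFinB -mulrBl -natr1 addrC addKr.
rewrite (eq_bigr (fun l : 'I_Q => ((P l)%:R / Q%:R)%:E)); last first.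
  by move=> l _; exact: FE.
rewrite sumEFin -mulr_suml -natr_sum; congr (_%:R / _)%:E.
have <- : index_iota 0 Q = iota 0 Q by rewrite /index_iota subn0.
rewrite -sum1_count big_mkord [RHS]big_mkcond /=.
by apply: eq_bigr => l _; case: (P l).
Qed.

End Circle.

Lemma rotation_perm (Q : nat) (c p : int) : (0 < Q)%N -> coprime Q `|p| ->
  perm_eq [seq `|(c + i%:Z * p) %% Q%:Z|%Z%N | i <- iota 1 Q] (iota 0 Q).
Proof.
move=> Q0 Qp.
have Qz : Q%:Z != 0 by lia.
set s := [seq _ | _ <- _].
have us : uniq s.
  rewrite map_inj_in_uniq ?iota_uniq // => i j; rewrite !mem_iota => hi hj e.
  have {e} : ((c + i%:Z * p) == (c + j%:Z * p) %[mod Q%:Z])%Z.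
    have m0 z : 0 <= (z %% Q%:Z)%Z by rewrite modz_ge0.
    by rewrite -(gez0_abs (m0 (c + i%:Z * p))) e gez0_abs.
  rewrite eqz_mod_dvd opprD addrACA subrr add0r -mulrBl.
  rewrite Gauss_dvdzl // dvdzE /=.
  move=> h; have : (`|i%:Z - j%:Z| < Q)%N by lia.
  by case: (posnP `|i%:Z - j%:Z|%N) => [|h0 /ltn_geF]; [lia|rewrite dvdn_leq].
have ss : {subset s <= iota 0 Q}.
  move=> _ /mapP[i _ ->]; rewrite mem_iota add0n /=.
  by rewrite -ltz_nat gez0_abs ?modz_ge0 ?ltz_pmod.
have [_ e] := uniq_min_size us ss ltac:(by rewrite size_map !size_iota).
by apply: uniq_perm => //; rewrite iota_uniq.
Qed.

(** * The truncated skew product *)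

Section Skew.
Variables (R : realType) (alpha : R) (k : nat -> nat).
Local Notation frac := Defs.frac.

Definition half_periods n : seq nat :=
  [seq (q alpha k n.+1 %/ (2 * q alpha k j))%N | j <- iota 1 n].

Definition haar_sum n (x : R) : int := \sum_(j <- iota 1 n) haar_ alpha k j x.

Lemma q_gt0 n : (0 < q alpha k n)%N.
Proof. by rewrite absz_gt0 denq_neq0. Qed.

Hypothesis hk : divisible_subsequence alpha k.

Lemma q_dvd i j : (0 < i < j)%N -> (2 * q alpha k i %| q alpha k j)%N.
Proof.
case/andP=> i0; elim: j => // j IH; rewrite ltnS leq_eqVlt => /orP[/eqP<-|ij].
  exact: (ds_dvd hk).
apply: dvdn_trans (IH ij) (dvdn_trans _ (ds_dvd hk _)); first exact: dvdn_mull.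
exact: ltn_trans ij.
Qed.

Lemma path_half_periods n :
  path (fun b c => 2 * c %| b)%N (q alpha k n.+1) (half_periods n).
Proof.
set Q := q alpha k n.+1.
(* the tail of the chain from index i on, with an arbitrary first multiple *)
have H s i L : (0 < i)%N -> (i + s <= n.+1)%N ->
    ((s == 0%N) || (2 * (Q %/ (2 * q alpha k i)) %| L)%N) ->
    path (fun b c => 2 * c %| b)%N L
      [seq (Q %/ (2 * q alpha k j))%N | j <- iota i s].
  elim: s i L => //= s IH i L i0 isn ->; apply: IH => //; first by lia.
  case: s isn => //= s isn.
  have /dvdnP[e Qe] : (2 * q alpha k i.+1 %| Q)%N by apply: q_dvd; lia.
  have /dvdnP[f qf] : (2 * q alpha k i %| q alpha k i.+1)%N.
    by apply: q_dvd; lia.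
  have -> : (Q %/ (2 * q alpha k i.+1) = e)%N.
    by rewrite Qe mulnK // muln_gt0 q_gt0.
  have -> : (Q %/ (2 * q alpha k i) = f * (2 * e))%N.
    rewrite Qe qf (_ : _ * _ = f * (2 * e) * (2 * q alpha k i))%N; last by lia.
    by rewrite mulnK // muln_gt0 q_gt0.
  exact: dvdn_mull.
apply: H => //; case: n @Q => [//|n] Q /=; apply/dvdnP.
have /dvdnP[e Qe] : (2 * q alpha k 1 %| Q)%N by apply: q_dvd.
exists (q alpha k 1).
by rewrite Qe mulnK ?muln_gt0 ?q_gt0 //; lia.
Qed.

Lemma haar_sumE n (x : R) :
  haar_sum n x
  = 2 * (evens (half_periods n) (cell (q alpha k n.+1) x))%:Z - n%:Z.
Proof.
set Q := q alpha k n.+1.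
rewrite /haar_sum /evens count_map -sum1_count.
rewrite -[X in _ - Posz X](size_iota 1 n) -sum1_size.
rewrite !(big_morph Posz PoszD (erefl _)) mulr_sumr.
rewrite [X in _ = X - _]big_mkcond -sumrB.
rewrite !big_seq; apply: eq_bigr => j; rewrite mem_iota => hj.
have jQ : (2 * q alpha k j %| Q)%N by apply: q_dvd; lia.
have d0 : (0 < Q %/ (2 * q alpha k j))%N.
  by rewrite divn_gt0 ?muln_gt0 ?q_gt0 // dvdn_leq ?q_gt0.
rewrite /haar_ (haar_cell _ _ d0) [(_ * (_ %/ _))%N]mulnC divnK //.
by rewrite /=; case: (odd _).
Qed.

Lemma haar_sum_frac n (x : R) : haar_sum n (frac x) = haar_sum n x.
Proof. by apply: eq_bigr => j _; rewrite /haar_ haar_frac. Qed.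

(** The cocycle telescopes along the orbit. The equality of fractional parts
    is what carries the induction through the reductions modulo 1. *)
Lemma iter_skew n (x : R) i :
  let z := iter i (Defs.skew alpha k n) (x, 0) in
  [/\ haar_sum n z.1 = haar_sum n (x + i%:R * alpha_ alpha k n.+1),
      frac z.1 = frac (x + i%:R * alpha_ alpha k n.+1)
    & z.2 * 2 = haar_sum n z.1 - haar_sum n x].
Proof.
elim: i => [|i [h1 h2 h3]] /=; first by rewrite mul0r addr0 subrr mul0r.
set z := iter i _ _ in h1 h2 h3 *; set al := alpha_ _ _ _ in h1 h2 *.
have fE : frac (z.1 + al) = frac (x + i.+1%:R * al).
  have -> : x + i.+1%:R * al =
      frac (x + i%:R * al) + al + (Num.floor (x + i%:R * al))%:~R.
    by rewrite /Defs.frac -natr1; ring.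
  rewrite fracDz -h2.
  rewrite -[in LHS](subrK (Num.floor z.1)%:~R z.1) -/(frac _).
  by rewrite addrAC fracDz.
have ffE (y : R) : frac (frac y) = frac y.
  by rewrite [LHS](@frac_eq _ (frac y) 0) subr0 ?frac_itv.
split; rewrite ?ffE //.
  by rewrite fE haar_sum_frac.
rewrite mulrDl h3 phi_exact /phi_sum sumrB haar_sum_frac.
have -> : index_iota 1 n.+1 = iota 1 n by rewrite /index_iota subn1.
rewrite -!/(haar_sum _ _); ring.
Qed.

(** The cells visited during times 1 to Q are all the cells, once each, and the
    height is 0 exactly at the visits with the same sum of signs as x. *)
Lemma returnsE n (x : R) :
  returns alpha k n x =
  count (fun l => evens (half_periods n) l
                  == evens (half_periods n) (cell (q alpha k n.+1) x))
    (iota 0 (q alpha k n.+1)).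
Proof.
set Q := q alpha k n.+1.
pose c := convergent alpha (k n.+1).
have Q0 : (0 < Q)%N := q_gt0 _.
have cop : coprime Q `|numq c|.
  by rewrite coprime_sym; apply: coprime_num_den.
rewrite -(permP (rotation_perm (cell Q x)%:Z Q0 cop)) count_map.
apply: eq_count => i /=.
have [h1 _ h3] := iter_skew n x i.
have alE : i%:R * alpha_ alpha k n.+1 = (i%:Z * numq c)%:~R / Q%:R :> R.
  rewrite /alpha_ -/c /ratr intrM mulrA.
  by rewrite -[Q%:R]/((Posz `|denq c|)%:~R) gez0_abs ?denq_ge0.
rewrite alE in h1.
rewrite -(cell_rotate _ _ Q0).
move: h3; rewrite h1 !haar_sumE; set e1 := evens _ _; set e2 := evens _ _.
by move: (_.2) => w h; apply/eqP/eqP; lia.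
Qed.

End Skew.

Theorem lemma5p3 (R : realType) (alpha : R) (k : nat -> nat)
  (halpha : divisible alpha) (hk : chosen_subsequence alpha k)
  (n : nat) (hn : (0 < n)%N) (m : int)
  (hm : - n%:Z <= m <= n%:Z) (hpar : (m = n%:Z %[mod 2])%Z) :
  exists A : set R,
    [/\ A `<=` circle R,
        measurable A,
        lebesgue_measure A
          = ('C(n, `|((n%:Z + m) %/ 2)%Z|%N)%:R / 2 ^+ n)%:E
      & forall x : R, A x ->
          (returns alpha k n x)%:R
            = (q alpha k n.+1)%:R / 2 ^+ n
              * 'C(n, `|((n%:Z + m) %/ 2)%Z|%N)%:R :> R].
Proof.
(* the sum of n signs is m when a of them are positive *)
set a := `|_|%N; have dk := cs_divisible hk.
set Q := q alpha k n.+1.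
pose ds := half_periods alpha k n.
have Q0 : (0 < Q)%N := q_gt0 _ _ _.
have Qn0 : Q%:R != 0 :> R by rewrite pnatr_eq0 -lt0n.
have cE : (count (fun l => evens ds l == a) (iota 0 Q))%:R
    = Q%:R / 2 ^+ n * 'C(n, a)%:R :> R.
  have := count_evens a (path_half_periods dk n).
  have size_ds : size ds = n by rewrite size_map size_iota.
  rewrite -/Q -/ds size_ds => /(congr1 (GRing.natmul (1 : R))).
  rewrite !natrM natrX mulrAC => <-.
  by rewrite mulrAC divff ?mul1r // expf_neq0.
have [mA muA] := @cells_measure R Q (fun l => evens ds l == a) Q0.
exists [set x | circle R x /\ evens ds (cell Q x) == a]; split => //.
- by move=> x [].
- rewrite muA cE; congr EFin; field.
  by rewrite Qn0 expf_neq0.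
- by move=> x [_ /eqP ea]; rewrite (returnsE dk) -/Q -/ds ea.
Qed.
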